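(* For all sufficiently large integers $n$, $$f_4(n)<0.164\, n^2 .$$
   Context: All graphs are finite and simple. A graph is $k$-chromatic if it is properly $k$-colorable but not properly $(k-1)$-colorable. A graph $G$ is $k$-critical if $G$ is $k$-chromatic but every proper subgraph of $G$ is $(k-1)$-colorable. $f_k(n)$ denotes the maximum number of edges in an $n$-vertex $k$-critical graph. *)

(* Defs.v *)
From HB Require Import structures.
From mathcomp Require Import all_boot all_order all_algebra.

Set Implicit Arguments.
Unset Strict Implicit.
Unset Printing Implicit Defensive.

Import Order.TTheory GRing.Theory Num.Theory.

(* A finite simple graph whose vertices are drawn from a finite universe [T].
   The vertex set is explicit, so that subgraphs may omit vertices as well as
   edges; an edge is a two-element set of vertices. *)
Definition graph_axiom (T : finType) (VE : {set T} * {set {set T}}) : bool :=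
  [forall e in VE.2, (e \subset VE.1) && (#|e| == 2)].

Record graph (T : finType) := Graph {
  graph_val : {set T} * {set {set T}};
  graph_valP : graph_axiom graph_val
}.

HB.instance Definition _ (T : finType) := [isSub for @graph_val T].
HB.instance Definition _ (T : finType) := [Finite of graph T by <:].

Definition vertices (T : finType) (G : graph T) : {set T} := (graph_val G).1.
Definition edges (T : finType) (G : graph T) : {set {set T}} := (graph_val G).2.

Definition subgraph (T : finType) (H G : graph T) : bool :=
  (vertices H \subset vertices G) && (edges H \subset edges G).

Definition proper_subgraph (T : finType) (H G : graph T) : bool :=
  subgraph H G && (H != G).

(* Only the vertices of [G] are coloured, not the whole universe [T]. *)
Definition colorable (k : nat) (T : finType) (G : graph T) : bool :=
  [exists c : {ffun {x : T | x \in vertices G} -> 'I_k},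
    [forall x, forall y, ([set val x; val y] \in edges G) ==> (c x != c y)]].

Definition chromatic (k : nat) (T : finType) (G : graph T) : bool :=
  colorable k G && ~~ colorable k.-1 G.

Definition critical (k : nat) (T : finType) (G : graph T) : bool :=
  chromatic k G &&
  [forall H : graph T, proper_subgraph H G ==> colorable k.-1 H].

(* Up to isomorphism an [n]-vertex graph has vertex set {0, ..., n-1}.  The
   value is 0 when there is no [k]-critical graph on [n] vertices. *)
Definition max_critical_edges (k n : nat) : nat :=
  \max_(G : graph 'I_n | (vertices G == [set: 'I_n]) && critical k G)
    #|edges G|.

(* Main.v *)
Require Import Defs.
From mathcomp Require Import all_boot all_order all_algebra.
From mathcomp Require Import ring lra zify.
Import Order.TTheory GRing.Theory Num.Theory.
Local Open Scope ring_scope.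

(** Let [G] be 4-critical on [n] vertices, with neighbourhoods [N v] and degrees
    [d v].  Deleting an edge [xy] makes [G] 3-colourable, and every such
    colouring gives [x] and [y] the same colour, so [N x] and [N y], apart from
    [x] and [y], only use the two other colours.  Two consequences carry the
    proof.

    First, if an edge [uv] lies in two triangles [u v w1] and [u v w2], then
    [w1] and [w2] have no further common neighbour ([diamond_common]).  Hence
    the sets [N w], for [w] adjacent to both ends of an edge, are almost
    disjoint, and an edge has boundedly many common neighbours of linear degree
    ([heavy_codeg]).  Up to few edges, [G] thus obeys Mantel's bound on every
    vertex set.

    Second, fix [y] and put [S = N y].  A triple in [S] that has [y] as its only
    common neighbour determines [y], so there are at most [n^3] such triples
    over all [y], and all but boundedly many vertices [y] are typical: they see
    few of them ([card_atypical]).  When [xy] is deleted, two vertices of [S]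
    that have a common neighbour in [N x] besides [y] get the same colour.  For
    a typical [y] and most [x] in [S] this applies to almost all pairs, so [S]
    is almost monochromatic.  As [x] cannot be recoloured with the majority
    colour, it has a neighbour [f x] of that colour, and [f x] has almost no
    neighbour in [S] ([private_neighbor]).
    If [f x = f u] for distinct [x] and [u], then [u] is in the minority for
    [x], so a common neighbour of [x] and [u] other than [y] has the majority
    colour and almost no neighbour in [S] either.

    Take for [y] a typical vertex of largest degree [s], let [P] (the set
    [rare]) consist of the vertices outside [S] with almost no neighbour in
    [S], and let [Q] (the set [common]) be the remaining vertices other than
    [y], with [p = #|P|] and [q = #|Q|].  The neighbourhoods in [Q] of the
    vertices sharing one private neighbour are disjoint, so, up to an
    arbitrarily small multiple of [n^2], there are at most [p q] edges between
    [S] and [Q] ([sum_good_common]).  With the same precision there are no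
    edges inside [S] ([card_clustered]) or between [S] and [P], and all degrees
    are at most [s].  So the number of edges is at most both
      [(p q + s (p + q)) / 2]   (summing degrees over [S] and its complement)
    and
      [q s + p^2 / 4]           (edges meeting [Q], and Mantel inside [P]).
    With weights 78/100 and 22/100 these two bounds and [s + p + q = n] give
    less than [0.1624 n^2] ([optimum_le]); the error terms fit into the
    remaining room. *)

Set Implicit Arguments.
Unset Strict Implicit.
Unset Printing Implicit Defensive.

Local Open Scope nat_scope.

(** * Counting neighbours *)

Lemma sum_card_disjoint (I T : finType) (W : pred I) (A : I -> {set T})
    (B : {set T}) :
    (forall i j z, W i -> W j -> z \in A i -> z \in A j -> i = j) ->
    (forall i, W i -> A i \subset B) ->
  \sum_(i | W i) #|A i| <= #|B|.
Proof.
move=> dj sub.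
have -> : \sum_(i | W i) #|A i| =
    \sum_(z in B) \sum_(i | W i && (z \in A i)) 1.
  under eq_bigr => i Wi do rewrite -sum1_card.
  rewrite (exchange_big_dep (mem B)) //= => i z Wi.
  exact: (subsetP (sub i Wi)).
rewrite -sum1_card; apply: leq_sum => z _; rewrite sum1_card.
apply/card_le1P => i /andP[Wi zi] j; rewrite !inE.
apply/idP/eqP => [/andP[Wj zj]|->]; last exact/andP.
exact: dj zj zi.
Qed.

Lemma ord3_cover (z : 'I_3) : exists a b : 'I_3,
  [/\ a != z, b != z, a != b & forall t : 'I_3, [\/ t = z, t = a | t = b]].
Proof.
have cov (i j k : 'I_3) : i != j -> j != k -> i != k ->
    forall t : 'I_3, [\/ t = i, t = j | t = k].
  move=> ij jk ik t; have: [|| t == i, t == j | t == k].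
    by case: i ij ik => [[|[|[|]]] ?] //; case: j jk => [[|[|[|]]] ?] //;
      case: k => [[|[|[|]]] ?] //; case: t => [[|[|[|]]] ?].
  by case/or3P=> /eqP->; [apply: Or31|apply: Or32|apply: Or33].
by case: z => [[|[|[|]]] ?] //;
  [exists (inord 1), (inord 2)|exists (inord 0), (inord 2)
  |exists (inord 0), (inord 1)];
  (split; last apply: cov); rewrite -val_eqE /= ?inordK.
Qed.

(** For a graph on the whole of [T] without isolated vertices this is
    4-criticality.  A colouring of the graph minus [xy] appears as one of the
    graph itself in which only the edge [xy] may have equal ends, so that no
    subgraph needs to be built. *)
Definition edge_critical (T : finType) (adj : rel T) : Prop :=
  [/\ symmetric adj, irreflexive adj,
      forall c : T -> 'I_3, exists u v, adj u v /\ c u = c v &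
      forall x y, adj x y -> exists c : T -> 'I_3, forall u v, adj u v ->
        c u = c v -> u = x /\ v = y \/ u = y /\ v = x].

Section Neighbourhoods.
Variables (T : finType) (adj : rel T).
Hypothesis adjC : symmetric adj.

Definition nbr (v : T) : {set T} := [set u | adj v u].
Definition deg (v : T) : nat := #|nbr v|.
Definition degsum (U : {set T}) : nat := \sum_(v in U) #|nbr v :&: U|.

Lemma in_nbr u v : (u \in nbr v) = adj v u.
Proof. by rewrite inE. Qed.

Lemma nbrC u v : (u \in nbr v) = (v \in nbr u).
Proof. by rewrite !inE adjC. Qed.

Lemma sum_cut (A B : {set T}) :
  \sum_(v in A) #|nbr v :&: B| = \sum_(v in B) #|nbr v :&: A|.
Proof.
have E (C D : {set T}) : \sum_(v in C) #|nbr v :&: D| =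
    \sum_(v in C) \sum_(u in D) adj v u.
  apply: eq_bigr => v _.
  rewrite -sum1_card big_mkcond [RHS]big_mkcond; apply: eq_bigr => u _.
  by rewrite !inE; case: (adj v u) (u \in D) => [] [].
rewrite !E exchange_big; apply: eq_bigr => v _; apply: eq_bigr => u _.
by rewrite adjC.
Qed.

(** An edge inside [U] but not inside [W] has an end in [U :\: W]; such edges
    are counted at most twice by the degrees there. *)
Lemma degsum_split (W U : {set T}) : W \subset U ->
  degsum U <= 2 * \sum_(v in U :\: W) #|nbr v :&: U| + degsum W.
Proof.
move=> sWU; rewrite /degsum (bigID (mem W)) /= addnC.
have -> : \sum_(v in U | v \notin W) #|nbr v :&: U| =
    \sum_(v in U :\: W) #|nbr v :&: U|.
  by apply: eq_bigl => v; rewrite !inE andbC.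
have -> : \sum_(v in U | v \in W) #|nbr v :&: U| =
    \sum_(v in W) (#|nbr v :&: W| + #|nbr v :&: (U :\: W)|).
  apply: eq_big => [v|v _].
    by apply: andb_idl; apply: (subsetP sWU).
  rewrite -(cardsID W (nbr v :&: U)) -setIA (setIidPr sWU); congr (_ + _).
  by apply: eq_card => u; rewrite !inE; do 3?case: (_ \in _); case: (adj _ _).
have : \sum_(v in W) #|nbr v :&: (U :\: W)| <=
    \sum_(v in U :\: W) #|nbr v :&: U|.
  by rewrite sum_cut; apply: leq_sum => v _; apply/subset_leq_card/setIS.
by rewrite big_split /=; lia.
Qed.

(** Mantel's theorem for graphs whose edges lie in few triangles.  For a vertex
    [v] of largest degree within [W], every edge inside [W] either meets the
    non-neighbours of [v] or lies inside the neighbourhood of [v], where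
    degrees are at most [k]. *)
Lemma degsum_codeg (W : {set T}) k :
    {in W &, forall u v, adj u v -> #|nbr u :&: nbr v :&: W| <= k} ->
  2 * degsum W <= #|W| ^ 2 + 2 * (#|W| * k).
Proof.
move=> codeg; case: (set_0Vmem W) => [->|[w0 w0W]].
  by rewrite /degsum big_set0.
pose f v := #|nbr v :&: W|.
case: (@arg_maxnP _ w0 (mem W) f w0W) => v vW fmax.
set M := nbr v :&: W.
have sMW : M \subset W by apply: subsetIr.
have far : \sum_(u in W :\: M) #|nbr u :&: W| <= (#|W| - #|M|) * #|M|.
  rewrite -cardsDS // -sum_nat_const.
  by apply: leq_sum => u /setDP[uW _]; apply: fmax.
have near : degsum M <= #|M| * k.
  rewrite /degsum -sum_nat_const; apply: leq_sum => u; rewrite in_setI in_nbr.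
  move=> /andP[vu uW].
  have := codeg u v uW vW; rewrite adjC => /(_ vu).
  by rewrite -setIA.
have le_M := subset_leq_card sMW.
have := degsum_split sMW; move: far near le_M.
move: (degsum W) (degsum M) (\sum_(_ in _) _) #|W| #|M| => a b c w t.
move=> le_c le_b /subnKC; move: (w - t) le_c => d le_c <- le_a.
have AM : 2 * (2 * (d * t)) <= (t + d) ^ 2.
  by rewrite sqrnD mul2n -addnn [d * t]mulnC leq_add2r; exact: nat_Cauchy.
by nia.
Qed.

Lemma degsumT : degsum [set: T] = \sum_v deg v.
Proof. by apply: eq_big => [v|v _]; rewrite ?inE ?setIT. Qed.

End Neighbourhoods.

(** * Colourings after deleting an edge *)

Section Critical.
Variables (T : finType) (adj : rel T).
Hypothesis crit : edge_critical adj.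

Local Notation N := (nbr adj).
Local Notation d := (deg adj).

Let adjC : symmetric adj. Proof. by case: crit. Qed.
Let adj_irr v : adj v v = false. Proof. by case: crit => _ /(_ v). Qed.

Lemma edge_coloring {x y : T} : adj x y -> exists c : T -> 'I_3,
  c x = c y /\
  forall u v, adj u v -> c u = c v -> u = x /\ v = y \/ u = y /\ v = x.
Proof.
case: crit => _ _ ncol sub xy; have [c cP] := sub x y xy; exists c; split=> //.
by have [u [v [uv cuv]]] := ncol c; case: (cP u v uv cuv) => -[<- <-].
Qed.

(** If [z] is a third common neighbour of [w1] and [w2], then deleting [w1 z]
    leaves a colouring with [w1] and [z] of the same colour.  The two triangles
    on [uv] give [w1] and [w2] the same colour as well, against the edge
    [w2 z]. *)
Lemma diamond_common u v w1 w2 : adj u v ->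
    w1 \in N u :&: N v -> w2 \in N u :&: N v -> w1 != w2 ->
  N w1 :&: N w2 \subset [set u; v].
Proof.
rewrite !inE => uv /andP[uw1 vw1] /andP[uw2 vw2] w12.
apply/subsetP => z; rewrite !inE => /andP[w1z w2z].
have [->//|zu] := eqVneq z u; have [//|zv] := eqVneq z v.
have [c [cz cP]] := edge_coloring w1z.
have proper a b : adj a b -> (a != w1) && (a != z) || (b != w1) && (b != z) ->
    c a != c b.
  move=> ab ne; apply/eqP => cab.
  by case: (cP a b ab cab) ne => -[-> ->]; rewrite !eqxx ?andbF.
have uw1' : u != w1 by apply: contraTneq uw1 => ->; rewrite adj_irr.
have vw1' : v != w1 by apply: contraTneq vw1 => ->; rewrite adj_irr.
have w2z' : w2 != z by apply: contraTneq w2z => ->; rewrite adj_irr.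
have := proper u v uv; rewrite uw1' eq_sym zu => /(_ isT) cuv.
have := proper u w1 uw1; rewrite uw1' eq_sym zu => /(_ isT) cuw1.
have := proper u w2 uw2; rewrite uw1' eq_sym zu => /(_ isT) cuw2.
have := proper v w1 vw1; rewrite vw1' eq_sym zv => /(_ isT) cvw1.
have := proper v w2 vw2; rewrite vw1' eq_sym zv => /(_ isT) cvw2.
have := proper w2 z w2z; rewrite eq_sym w12 w2z' => /(_ isT); rewrite -cz.
have [a [b [au bu ab cov]]] := ord3_cover (c u).
by case: (cov (c v)) cuv cvw1 cvw2 => ->; rewrite ?eqxx // => _;
  case: (cov (c w1)) cuw1 => ->; rewrite ?eqxx // => _;
  case: (cov (c w2)) cuw2 => ->; rewrite ?eqxx // => _.
Qed.

Definition heavy (h : nat) : {set T} := [set v | h <= d v].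

(** By [diamond_common] the sets [N w :\: [set u; v]], for [w] a common neighbour
    of [u] and [v], are disjoint, and they have at least [h - 2] elements for
    heavy [w]. *)
Lemma heavy_codeg h k u v : #|T| < k.+1 * (h - 2) -> adj u v ->
  #|N u :&: N v :&: heavy h| <= k.
Proof.
move=> big uv; set W := _ :&: heavy h; rewrite leqNgt; apply/negP => ltk.
have sub w : w \in W -> h - 2 <= #|N w :\: [set u; v]|.
  rewrite !inE => /andP[_ hw].
  rewrite cardsD; apply: leq_sub => //.
  by rewrite (leq_trans (subset_leq_card (subsetIr _ _))) // cards2; case: eqP.
have le_n : \sum_(w in W) #|N w :\: [set u; v]| <= #|T|.
  rewrite -cardsT; apply: sum_card_disjoint => [w1 w2 z|*]; last exact: subsetT.
  move=> /setIP[w1uv _] /setIP[w2uv _] /setDP[z1 zuv] /setDP[z2 _].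
  apply: contraNeq zuv => w12.
  by apply: (subsetP (diamond_common uv w1uv w2uv w12)); apply/setIP.
have : #|W| * (h - 2) <= #|T|.
  by apply: leq_trans le_n; rewrite -sum_nat_const; apply: leq_sum.
by rewrite leqNgt (leq_trans big) // leq_mul2r ltk orbT.
Qed.

(** For [x] in [N y], the pairs [(u, v)] whose colours are not forced to agree
    by a common neighbour in [N x] when the edge [xy] is deleted. *)
Definition bad_pairs (y x : T) : {set T * T} :=
  [set uv | N x :&: N uv.1 :&: N uv.2 == [set y]].

(** The threshold [m ^ 2] ensures that of two disjoint sets all of whose cross
    pairs are bad, one has at most [m] elements. *)
Definition wild (m : nat) (y : T) : {set T} :=
  [set x in N y | m ^ 2 < #|bad_pairs y x|].

Definition typical (m : nat) : {set T} := [set y | #|wild m y| <= m].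

(** Each triple [(x, u, v)] is bad for at most one [y], because [y] is then the
    only common neighbour of [x], [u] and [v]. *)
Lemma card_atypical m : #|~: typical m| * m ^ 3 <= #|T| ^ 3.
Proof.
have le3 : \sum_y \sum_x #|bad_pairs y x| <= #|T| ^ 3.
  rewrite exchange_big /= expnS -sum_nat_const; apply: leq_sum => x _.
  rewrite -mulnn -card_prod -cardsT.
  apply: sum_card_disjoint => [y z uv _ _|*]; last exact: subsetT.
  by rewrite !inE => /eqP -> /eqP /set1_inj.
apply: leq_trans le3.
rewrite -sum_nat_const big_mkcond; apply: leq_sum => y _ /=.
case: ifP => //; rewrite !inE -ltnNge => /ltnW my.
apply: (@leq_trans (\sum_(x in wild m y) m ^ 2)).
  by rewrite sum_nat_const expnS leq_mul2r my orbT.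
rewrite big_mkcond; apply: leq_sum => x _; case: ifP => //.
by rewrite inE => /andP[_ /ltnW].
Qed.

(** Colour the graph without [xy].  The two colours other than that of [x]
    split [N y :\ x] into classes whose product consists of bad pairs, so one
    class, [R], has at most [m] elements.  The vertex [p] is an obstruction to
    recolouring [x] with the other (majority) colour.  Any neighbour of [x],
    except [y], that has the majority colour sees only [x] and [R] in [N y];
    this applies to [p], and to the common neighbours of [x] and an element
    of [R]. *)
Lemma private_neighbor m x y : adj x y -> #|bad_pairs y x| <= m ^ 2 ->
  exists p (R : {set T}),
    [/\ [/\ #|R| <= m, adj x p & p != y], N p :&: N y \subset x |: R,
     forall u w, u \in N y -> w \in N y -> adj u w ->
       (u \in x |: R) || (w \in x |: R) &
     forall u z, u \in R -> z \in N u :&: N x -> z != y ->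
       N z :&: N y \subset x |: R].
Proof.
move=> xy bad.
have [c [cxy cP]] := edge_coloring xy.
have proper a b : adj a b -> (a != x) && (a != y) || (b != x) && (b != y) ->
    c a != c b.
  move=> ab ne; apply/eqP => cab.
  by case: (cP a b ab cab) ne => -[-> ->]; rewrite !eqxx ?andbF.
have neq u v : adj u v -> v != u.
  by apply: contraTneq => ->; rewrite adj_irr.
have cX z : adj x z -> z != y -> c z != c x.
  by move=> xz zy; rewrite eq_sym proper // zy (neq _ _ xz) ?orbT.
have cY z : adj y z -> z != x -> c z != c x.
  by move=> yz zx; rewrite eq_sym cxy proper // zx (neq _ _ yz) ?orbT.
pose S a := [set u in N y | (u != x) && (c u == a)].
have [a [b [ax bx ab cov small]]] : exists a b : 'I_3,
    [/\ a != c x, b != c x, a != b,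
        forall t : 'I_3, [\/ t = c x, t = a | t = b] & #|S b| <= m].
  have [a [b [ax bx ab cov]]] := ord3_cover (c x).
  have : #|setX (S a) (S b)| <= m ^ 2.
    apply: leq_trans bad; apply: subset_leq_card; apply/subsetP => -[u v].
    rewrite !inE /= => /andP[/and3P[yu ux /eqP cu] /and3P[yv vx /eqP cv]].
    apply/eqP/setP => z; rewrite !inE; have [->|zy] := eqVneq z y.
      by rewrite xy adjC yu adjC yv.
    apply/negP => /andP[/andP[xz uz] vz].
    have zx := neq _ _ xz; have cz := cX z xz zy.
    have := proper u z uz; rewrite zx zy orbT cu => /(_ isT).
    have := proper v z vz; rewrite zx zy orbT cv => /(_ isT).
    by case: (cov (c z)) cz => ->; rewrite eqxx.
  rewrite cardsX -mulnn => le_m.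
  have [leb|ltb] := leqP #|S b| m; first by exists a, b.
  exists b, a; split=> //; first by rewrite eq_sym.
    by move=> t; case: (cov t) => ->; [apply: Or31|apply: Or33|apply: Or32].
  by nia.
have mono z : adj z x -> z != y -> c z = a -> N z :&: N y \subset x |: S b.
  move=> zx zy cz; apply/subsetP => u; rewrite !inE => /andP[zu yu].
  have [//|ux /=] := eqVneq u x; rewrite yu /=.
  have zx' : z != x by rewrite neq // adjC.
  have := proper z u zu; rewrite zy zx' cz => /(_ isT).
  by have := cY u yu ux; case: (cov (c u)) => ->; rewrite eqxx.
have [p [xp py cp]] : exists p, [/\ adj x p, p != y & c p = a].
  have ncol : forall c : T -> 'I_3, exists u v, adj u v /\ c u = c v.
    by case: crit.
  have [u [v [uv]]] := ncol (fun v => if v == x then a else c v).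
  case: eqP => [ux|ux]; case: eqP => [vx|vx].
  - by rewrite ux vx adj_irr in uv.
  - move=> cv; rewrite ux in uv; exists v; split=> //.
    by apply: contra_neq ax => vy; rewrite cv vy.
  - move=> cv; rewrite vx adjC in uv; exists u; split=> //.
    by apply: contra_neq ax => uy; rewrite -cv uy.
  - by move=> cuv; case: (cP u v uv cuv) => -[].
exists p, (S b); split.
- by split.
- by apply: mono; rewrite // adjC.
- move=> u w; rewrite !in_setU1 !in_nbr => yu yw uw.
  have [//|ux] := eqVneq u x; have [|wx] := eqVneq w x; first by rewrite orbT.
  rewrite !inE ux wx yu yw /=.
  have := proper u w uw; rewrite ux (neq _ _ yu) => /(_ isT).
  have := cY w yw wx; have := cY u yu ux.
  by case: (cov (c u)) => ->; case: (cov (c w)) => ->; rewrite !eqxx ?orbT.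
- move=> u z; rewrite !inE => /and3P[yu ux /eqP cu] /andP[uz xz] zy.
  apply: mono; rewrite 1?adjC //.
  have := cX z xz zy; have := proper u z uz.
  rewrite zy (neq _ _ xz) orbT cu => /(_ isT).
  by case: (cov (c z)) => ->; rewrite ?eqxx.
Qed.

End Critical.

(** * The two bounds on the degree sum *)

Section Count.
Variables (T : finType) (adj : rel T).
Hypothesis crit : edge_critical adj.

Local Notation N := (nbr adj).
Local Notation d := (deg adj).
Local Notation heavy := (heavy adj).
Local Notation wild := (wild adj).
Local Notation typical := (typical adj).

Let adjC : symmetric adj. Proof. by case: crit. Qed.
Let adj_irr v : adj v v = false. Proof. by case: crit => _ /(_ v). Qed.

Variables (h m k : nat) (y : T).

Local Notation S := (N y).
Local Notation n := #|T|.

Definition clustered : {set T} := [set u in S :&: heavy h | N u :&: S != set0].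

Definition good : {set T} := S :&: heavy h :\: (wild m y :|: clustered).

Definition rare : {set T} :=
  [set z | [&& z \notin S, z != y & #|N z :&: S| <= m.+1]].
Definition common : {set T} :=
  [set z | [&& z \notin S, z != y & m.+1 < #|N z :&: S|]].

Lemma card_parts : #|S| + #|rare| + #|common| + 1 = n.
Proof.
have yS : y \notin S by rewrite in_nbr adj_irr.
have : #|~: S :\ y| = #|rare| + #|common|.
  rewrite -(cardsID [set z | #|N z :&: S| <= m.+1]); congr (_ + _);
    apply: eq_card => z; rewrite !inE -?ltnNge;
    by case: (adj y z) (z == y) (_ <= _) => [] [] [].
have := cardsD1 y (~: S); have := cardsC S; rewrite inE yS; lia.
Qed.

Lemma good_indep x : x \in good -> N x :&: S = set0.
Proof.
rewrite in_setD in_setU negb_or => /andP[/andP[_ +] Sh].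
by rewrite inE Sh /= => /negPn/eqP.
Qed.

(** Send each good [x] to a private neighbour [p x], which is rare.  If a common
    vertex [z] were adjacent to two vertices [x] and [u] with the same image,
    [u] would be in the minority for [x], so [z] would have the majority colour
    and hence be rare.  So each fibre of [p] contributes at most [#|common|]. *)
Lemma sum_good_common :
  \sum_(x in good) #|N x :&: common| <= #|rare| * #|common|.
Proof.
have /fin_all_exists[p pP] : forall x, exists p, x \in good ->
    [/\ p \in rare, x \in N p & forall u z, u \in N p -> u \in S -> u != x ->
       z \in N u :&: N x -> z != y -> #|N z :&: S| <= m.+1].
  move=> x.
  have [gx|] := boolP (x \in good); last by exists x.
  have [Sx tame] : x \in S /\ #|bad_pairs adj y x| <= m ^ 2.
    move: gx; rewrite in_setD in_setU negb_or => /andP[/andP[+ _] /setIP[Sx _]].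
    by rewrite inE Sx -leqNgt.
  have xy : adj x y by rewrite adjC -in_nbr.
  have [p [R [[R_le xp py] pR _ RP]]] := private_neighbor crit xy tame.
  have small (A : {set T}) : A \subset x |: R -> #|A| <= m.+1.
    move=> /subset_leq_card/leq_trans; apply.
    by rewrite cardsU1; case: (x \in R) => //=; lia.
  exists p => _; split.
  - rewrite inE py small // !andbT; apply/negP => Sp.
    by have /setP/(_ p) := good_indep gx; rewrite in_setI Sp in_nbr xp inE.
  - by rewrite in_nbr adjC.
  move=> u z pu Su ux uz zy; apply: small; apply: (RP u z) => //.
  have : u \in x |: R by apply: (subsetP pR); rewrite in_setI pu.
  by rewrite in_setU1 (negbTE ux).
rewrite (partition_big p (mem rare)) /= => [|x /pP[]//].
rewrite -sum_nat_const; apply: leq_sum => q _.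
apply: sum_card_disjoint => [x u z|x _]; last exact: subsetIr.
move=> /andP[gx /eqP px] /andP[gu /eqP pu] /setIP[xz cz] /setIP[uz _].
have [_ _ fibre] := pP x gx; have [_ up _] := pP u gu.
have Su : u \in S by move: gu; rewrite in_setD in_setI => /and3P[].
move: cz; rewrite inE => /and3P[_ zy]; rewrite ltnNge => /negP small.
apply/eqP/negPn/negP => xu; apply: small; apply: (fibre u) => //.
- by rewrite px -pu.
- by rewrite eq_sym.
- by rewrite in_setI uz.
Qed.

Local Notation s := #|S|.
Local Notation p := #|rare|.
Local Notation q := #|common|.

Lemma sum_good_rare : \sum_(x in good) #|N x :&: rare| <= p * m.+1.
Proof.
apply: (@leq_trans (\sum_(x in S) #|N x :&: rare|)).
  rewrite big_mkcond [leqRHS]big_mkcond; apply: leq_sum => x _.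
  by case: ifP => //; rewrite in_setD in_setI => /and3P[_ ->].
rewrite sum_cut // -sum_nat_const; apply: leq_sum => z.
by rewrite inE => /and3P[].
Qed.

Hypothesis codeg : forall u v, adj u v -> #|N u :&: N v :&: heavy h| <= k.
Hypothesis y_typical : y \in typical m.

(** One tame [x] suffices: in its colouring every edge inside [S] touches the
    small set [x |: R], and each vertex of that set has at most [k] heavy
    neighbours in [S], because these are common neighbours with [y]. *)
Lemma card_clustered : #|clustered| <= m.+1 * k.+1.
Proof.
have [sub|/subsetPn[x Sx]] := boolP (S \subset wild m y).
  have le_m : #|S| <= m.
    by apply: leq_trans (subset_leq_card sub) _; move: y_typical; rewrite inE.
  apply: (@leq_trans #|S|); last by nia.
  by apply/subset_leq_card/subsetP => u; rewrite !inE => /andP[/andP[]].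
rewrite inE Sx -leqNgt /= => tame; have xy : adj x y by rewrite adjC -in_nbr.
have [p [R [[R_le _ _] _ touch _]]] := private_neighbor crit xy tame.
have card_xR : #|x |: R| <= m.+1.
  by rewrite cardsU1; case: (x \in R) => //=; lia.
pose V w := w |: (N w :&: S :&: heavy h).
have sub : clustered \subset \bigcup_(w in (x |: R) :&: S) V w.
  apply/subsetP => u; rewrite inE.
  move=> /andP[/setIP[Su hu] /set0Pn[w /setIP[uw Sw]]].
  have [uR|uR] := boolP (u \in x |: R).
    by apply/bigcupP; exists u; rewrite ?in_setI ?uR //; apply: setU11.
  have := touch u w Su Sw; rewrite -in_nbr uw (negbTE uR) /= => /(_ isT) wR.
  apply/bigcupP; exists w; rewrite ?in_setI ?wR //; apply/setU1P; right.
  by rewrite !in_setI hu Su nbrC // uw.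
apply: leq_trans (subset_leq_card sub) _.
have cardV w : w \in (x |: R) :&: S -> #|V w| <= k.+1.
  move=> /setIP[_ Sw]; rewrite cardsU1 -add1n leq_add ?leq_b1 //.
  by apply: codeg; rewrite adjC -in_nbr.
rewrite [leqRHS]mulnC.
apply: (@leq_trans (k.+1 * #|(x |: R) :&: S|)); last first.
  by rewrite leq_mul2l (leq_trans (subset_leq_card (subsetIl _ _))).
rewrite mulnC -sum_nat_const; move: cardV.
elim/big_rec2: _ => [_|w a A wxR IH cardV]; first by rewrite cards0.
apply: leq_trans (leq_card_setU _ _) _.
by apply: leq_add; [apply: cardV|apply: IH].
Qed.

(** Only good vertices matter: the others in [S] have degree below [h] or are
    few. *)
Lemma sum_S_split (f : T -> nat) : (forall x, f x <= d x) ->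
  \sum_(x in S) f x <= n * h + (m + m.+1 * k.+1) * n + \sum_(x in good) f x.
Proof.
move=> fd; rewrite (bigID (mem (heavy h))) /= addnC -addnA; apply: leq_add.
  apply: (@leq_trans (\sum_(x in S) h)).
    rewrite big_mkcondr; apply: leq_sum => x _; case: ifP => //.
    by rewrite inE -ltnNge => /ltnW; apply: leq_trans.
  by rewrite sum_nat_const leq_mul2r max_card orbT.
rewrite (bigID (mem good)) /= addnC; apply: leq_add.
  apply: (@leq_trans (\sum_(x in wild m y :|: clustered) n)).
    rewrite big_mkcond [leqRHS]big_mkcond; apply: leq_sum => x _.
    case: ifP => // /andP[/andP[Sx hx]].
    rewrite in_setD negb_and negbK in_setI Sx hx orbF => -> //.
    by apply: leq_trans (fd x) (max_card _).
  rewrite sum_nat_const leq_mul2r; apply/orP; right.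
  apply: leq_trans (leq_card_setU _ _) _; apply: leq_add card_clustered.
  by move: y_typical; rewrite inE.
apply: eq_leq; apply: eq_bigl => x; rewrite in_setD in_setI.
by case: (x \in S) (x \in heavy h) => [] [] /=; rewrite ?andbF ?andbT.
Qed.

Local Notation b := #|~: typical m|.

Hypothesis y_max : forall v, v \in typical m -> d v <= d y.

Lemma sum_deg_le (A : {set T}) : \sum_(v in A) d v <= #|A| * s + b * n.
Proof.
rewrite (bigID (mem (typical m))) /=; apply: leq_add.
  rewrite -sum_nat_const big_mkcondr; apply: leq_sum => v _.
  by case: ifP => // /y_max.
rewrite -sum_nat_const big_mkcond [leqRHS]big_mkcond; apply: leq_sum => v _.
by rewrite in_setC; case: ifP => // /andP[_ ->]; apply: max_card.
Qed.

Local Notation err := (n * h + (m + m.+1 * k.+1) * n).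

(** Sum the degrees over [S], where the good vertices send at most [p * q] edges
    to [common] and few to [rare], and bound the degrees elsewhere by [s]. *)
Lemma degree_sum_le_private :
  \sum_v d v <= err + p * q + p * m.+1 + n + (p + q + 1) * s + b * n.
Proof.
have inS : \sum_(x in S) d x <= err + (p * q + p * m.+1 + n).
  apply: leq_trans (sum_S_split (fun=> leqnn _)) _; rewrite leq_add2l.
  apply: (@leq_trans (\sum_(x in good)
      (#|N x :&: common| + #|N x :&: rare| + 1))).
    apply: leq_sum => x gx.
    have sub : N x \subset (N x :&: common :|: N x :&: rare) :|: [set y].
      apply/subsetP => z xz; have /setP/(_ z) := good_indep gx.
      rewrite !inE; move: xz; rewrite inE => -> /= ->.
      by case: (z == y) (leqP #|N z :&: S| m.+1) => [] [].
    apply: leq_trans (subset_leq_card sub) _.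
    apply: leq_trans (leq_card_setU _ _) _; rewrite cards1 leq_add2r.
    exact: leq_card_setU.
  rewrite !big_split /= sum1_card; apply: leq_add (max_card _).
  exact: leq_add sum_good_common sum_good_rare.
have outS := sum_deg_le (~: S).
have -> : \sum_v d v = \sum_(v in S) d v + \sum_(v in ~: S) d v.
  by rewrite (bigID (mem S)) /=; congr (_ + _); apply: eq_bigl => v; rewrite !inE.
have := cardsC S; have := card_parts; move: outS inS.
move=> outS inS E1 E2; have E3 : #|~: S| = p + q + 1 by lia.
by rewrite E3 in outS; lia.
Qed.

(** Peel off the complement of [S :|: rare], then [S], then the light vertices of
    [rare].  What remains is covered by Mantel's bound for [rare :&: heavy h]. *)
Lemma degree_sum_le_Mantel :
  2 * \sum_v d v <= 4 * ((q + 1) * s + b * n) + 4 * (err + p * m.+1)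
    + 4 * (n * h) + p ^ 2 + 2 * (p * k).
Proof.
pose U := S :|: rare.
have disj x : x \in S -> x \notin rare by rewrite !inE => ->.
have cU : #|~: U| = q + 1.
  have := cardsC U; have := card_parts; rewrite cardsU.
  suff -> : S :&: rare = set0 by rewrite cards0; lia.
  by apply/setP => x; rewrite in_setI in_set0; case: (boolP (x \in S)) => // /disj /negbTE.
have B1 := degsum_split adjC (subsetT U).
have {B1} : degsum adj [set: T] <= 2 * ((q + 1) * s + b * n) + degsum adj U.
  apply: leq_trans B1 _; rewrite leq_add2r leq_mul2l /= -cU.
  apply: leq_trans (sum_deg_le _); rewrite setTD.
  by apply: leq_sum => v _; rewrite setIT.
have B2 := degsum_split adjC (subsetUr S rare).
have {B2} : degsum adj U <= 2 * (err + p * m.+1) + degsum adj rare.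
  apply: leq_trans B2 _; rewrite leq_add2r leq_mul2l /=.
  have -> : \sum_(v in U :\: rare) #|N v :&: U| = \sum_(v in S) #|N v :&: U|.
    apply: eq_bigl => v; rewrite in_setD in_setU.
    by case: (boolP (v \in S)) => [/disj ->|] //=; case: (v \in rare).
  apply: leq_trans (sum_S_split _) _ => [x|].
    exact/subset_leq_card/subsetIl.
  rewrite leq_add2l; apply: leq_trans sum_good_rare; apply: leq_sum => x gx.
  by rewrite setIUr good_indep // set0U.
pose W := rare :&: heavy h.
have B3 := degsum_split adjC (subsetIl rare (heavy h)).
have {B3} : degsum adj rare <= 2 * (n * h) + degsum adj W.
  apply: leq_trans B3 _; rewrite leq_add2r leq_mul2l /=.
  apply: (@leq_trans (\sum_(v in rare :\: W) h)).
    apply: leq_sum => v /setDP[rv]; rewrite in_setI rv inE -ltnNge => /ltnW.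
    exact/leq_trans/subset_leq_card/subsetIl.
  by rewrite sum_nat_const leq_mul2r max_card orbT.
have : 2 * degsum adj W <= #|W| ^ 2 + 2 * (#|W| * k).
  apply: degsum_codeg => // u v _ _ /codeg; apply: leq_trans.
  by rewrite subset_leq_card // setIS // subsetIr.
have : #|W| <= p by apply: subset_leq_card; apply: subsetIl.
rewrite degsumT => leW; have le2 : #|W| ^ 2 <= p ^ 2 by rewrite leq_sqr.
have lek : #|W| * k <= p * k by rewrite leq_mul2r leW orbT.
by lia.
Qed.

End Count.

Local Open Scope ring_scope.

(** * Optimization and choice of constants *)

(** With [n = 1] the left side is a concave function of [(s, p)], with maximum
    about 0.162397 at [p = 17/73] and [s = (1 - p) / 2]. *)
Lemma optimum_le (F : realFieldType) (n s p : F) :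
  22/100 * ((n - s - p) * s + p ^+ 2 / 4%:R)
    + 39/100 * (p * (n - s - p) + s * (n - s)) <= 1624/10000 * n ^+ 2.
Proof.
have := sqr_ge0 (s + p / 2%:R - n / 2%:R); have := sqr_ge0 (p - 17/73 * n).
have := sqr_ge0 n; nra.
Qed.

(** The weights 22/100 and 78/100 give the left side of [optimum_le] as main term
    for [D / 2].  What exceeds it is at most
    [n * (0.83 h + 612 m + 0.61 b + O(1))], so below [0.0016 n ^ 2]. *)
Lemma combine_bounds (F : realFieldType) (n s p q b h m k D C : F) :
    [/\ 0 <= n, 0 <= m, 0 <= p & 0 <= b] -> p <= n -> s + p + q + 1 = n ->
    let err := n * h + (m + (m + 1) * (k + 1)) * n in
    2 * D <= 4 * ((q + 1) * s + b * n) + 4 * (err + p * (m + 1))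
      + 4 * (n * h) + p ^+ 2 + 2 * (p * k) ->
    D <= err + p * q + p * (m + 1) + n + (p + q + 1) * s + b * n ->
    k = 1000 -> 1000 * h <= n -> 1000 * (1000 * m) <= n -> b <= C -> 0 <= C ->
    10000 * C <= n -> 1000 * (1000 * 100) <= n ->
  D < 328 / 1000 * n ^+ 2.
Proof.
move=> [n0 m0 p0 b0] pn sum err I1 I2 k1000 hn mn bC C0 Cn big.
have opt := optimum_le n s p.
have qE : q = n - s - p - 1 by rewrite -sum; ring.
have e1 := ler_wpM2l n0 hn; have e2 := ler_wpM2l n0 mn.
have bn : 10000 * b <= n by move: bC Cn; clear; lra.
have e3 := ler_wpM2l n0 bn.
have e4 := ler_wpM2r (addr_ge0 m0 ler01) pn.
have e5 := ler_wpM2l n0 big.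
have e6 := ler_wpM2r (ler0n F 1000) pn.
have n2 : 0 < n * n by apply: mulr_gt0; clear -big; lra.
rewrite {}/err in I1 I2; rewrite {}qE {}k1000 in I1 I2.
rewrite !expr2 in opt I1 I2 *.
clear -opt e1 e2 e3 e4 e5 e6 n2 I1 I2.
lra.
Qed.


(** The thresholds are [h] about [n / 10 ^ 3] and [m] about [n / 10 ^ 6].  Then
    [k = 1000] is admissible in [heavy_codeg], and the number of atypical
    vertices stays below the constant [C]. *)
Lemma critical_degree_sum (F : archiRealFieldType) : exists N0 : nat,
  forall (T : finType) (adj : rel T), edge_critical adj -> (N0 <= #|T|)%N ->
    (\sum_v deg adj v)%:R < 328 / 1000 * #|T|%:R ^+ 2 :> F.
Proof.
pose A : F := 2 * (1000 * 1000); pose C : F := A ^+ 3.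
have A0 : 0 < A by rewrite /A; lra.
have C0 : 0 < C by apply: exprn_gt0.
pose N1 : F := 10000 * C + 1000 * (1000 * 1000).
exists (Num.truncn N1).+1 => T adj crit big.
have {big} big : N1 < #|T|%:R.
  by apply: lt_le_trans (truncnS_gt N1) _; rewrite ler_nat.
have [nC n1] : 10000 * C <= #|T|%:R :> F /\ 1000 * (1000 * 1000) <= #|T|%:R :> F.
  by move: big C0; rewrite /N1; clearbody C; clear; split; lra.
(* The witness is hidden so that its unary numeral is never computed. *)
have [k kE] : exists k : nat, k%:R = 1000 :> F by exists 1000%N.
have n0 : 0 <= #|T|%:R :> F by apply: ler0n.
have [h [hn hgt]] : exists h : nat,
    1000 * h%:R <= #|T|%:R :> F /\ #|T|%:R < 1000 * (h%:R + 1) :> F.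
  exists (Num.truncn (#|T|%:R / 1000 : F)).
  have /truncn_itv : 0 <= #|T|%:R / 1000 :> F by rewrite divr_ge0 ?ler0n.
  by move=> /andP[lo hi]; clear -lo hi; split; lra.
have [m [mn mgt]] : exists m : nat, 1000 * (1000 * m%:R) <= #|T|%:R :> F /\
    #|T|%:R < 1000 * (1000 * (m%:R + 1)) :> F.
  exists (Num.truncn (#|T|%:R / 1000 / 1000 : F)).
  have /truncn_itv : 0 <= #|T|%:R / 1000 / 1000 :> F by rewrite !divr_ge0 ?ler0n.
  by move=> /andP[lo hi]; clear -lo hi; split; lra.
have codeg u v : adj u v -> (#|nbr adj u :&: nbr adj v :&: heavy adj h| <= k)%N.
  apply: heavy_codeg => //.
  have h2 : (2 <= h)%N.
    by rewrite -(ler_nat F); move: hgt n1; clear; lra.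
  rewrite -(ltr_nat F) natrM natrB // -(natr1 k) kE.
  by move: hgt n1; clear; lra.
have bC : #|~: typical adj m|%:R <= C.
  have nm : #|T|%:R <= A * m%:R by rewrite /A; move: mgt n1; clear; lra.
  have m3 : 0 < m%:R ^+ 3 :> F.
    by apply: exprn_gt0; move: mgt n1; clear; lra.
  rewrite -(ler_pM2r m3) /C -exprMn; apply: le_trans (lerXn2r 3 _ _ nm).
  - by rewrite -!natrX -natrM ler_nat card_atypical.
  - by rewrite nnegrE.
  - by rewrite nnegrE (le_trans n0).
have [y0 y0t] : exists y0, y0 \in typical adj m.
  have : (#|~: typical adj m| < #|T|)%N.
    by rewrite -(ltr_nat F); move: bC nC C0; clear; lra.
  rewrite -(cardsC (typical adj m)) -[ltnLHS]add0n ltn_add2r => /card_gt0P[y yt].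
  by exists y.
case: (@arg_maxnP _ y0 (mem (typical adj m)) (deg adj) y0t) => y yt ymax.
have I1 := degree_sum_le_Mantel crit codeg yt ymax.
have I2 := degree_sum_le_private crit codeg yt ymax.
have sum := card_parts crit m y.
rewrite -(ler_nat F) !(natrD, natrM, natrX) -(natr1 m) -(natr1 k) in I1.
rewrite -(ler_nat F) !(natrD, natrM, natrX) -(natr1 m) -(natr1 k) in I2.
move: sum => /(congr1 (fun i : nat => i%:R : F)); rewrite /= !natrD => sum.
apply: (@combine_bounds _ _ _ _ _ _ _ _ _ _ C _ _ sum I1 I2) => //.
- by rewrite ler_nat max_card.
- exact: ltW.
- by move: n1; clear; lra.
Qed.

(** * From critical graphs to the theorem *)

Lemma critical_edge_critical (T : finType) (G : graph T) :
    vertices G = [set: T] -> critical 4 G ->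
  edge_critical (fun u v => [set u; v] \in edges G).
Proof.
move=> vG /andP[/andP[_ ncol] /forallP sub].
have axG e : e \in edges G -> (e \subset vertices G) && (#|e| == 2%N).
  by have := graph_valP G; rewrite /graph_axiom => /forall_inP; apply.
split.
- by move=> u v; rewrite setUC.
- by move=> v; apply/negP => /axG; rewrite setUid cards1 andbF.
- move=> c; move: ncol; rewrite negb_exists.
  move/forallP/(_ [ffun x => c (val x)]); rewrite negb_forall => /existsP[x].
  rewrite negb_forall => /existsP[z]; rewrite negb_imply negbK !ffunE.
  by move=> /andP[xz /eqP cxz]; exists (val x), (val z).
move=> x y xy.
have ax : graph_axiom (vertices G, edges G :\ [set x; y]).
  by apply/forall_inP => e /setD1P[_ /axG].
have := sub (Graph ax); rewrite /proper_subgraph /subgraph /=.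
rewrite subxx /= subsetDl /=.
have -> /= : Graph ax != G.
  apply/eqP => /(congr1 (@edges T)) /setP/(_ [set x; y]).
  by rewrite !inE eqxx xy.
move=> /existsP[c cP].
have inG v : v \in vertices (Graph ax) by rewrite [vertices _]vG inE.
exists (fun v => c (Sub v (inG v))) => u v uv cuv.
move: cP => /forallP/(_ (Sub u (inG u)))/forallP/(_ (Sub v (inG v))).
rewrite cuv eqxx implybF /= !inE uv andbT negbK => /eqP E.
have /setP/(_ u) := E; have /setP/(_ v) := E; rewrite !inE !eqxx ?orbT /=.
have uv' : u != v.
  by apply: contraTneq uv => ->; apply/negP => /axG; rewrite setUid cards1 andbF.
move=> /esym/orP[]/eqP vE /esym/orP[]/eqP uE; move: uv'; rewrite uE vE ?eqxx //.
- by right.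
- by left.
Qed.

Lemma double_card_edges (T : finType) (G : graph T) :
  (2 * #|edges G| <= \sum_v deg (fun u v => [set u; v] \in edges G) v)%N.
Proof.
have axG e : e \in edges G -> #|e| = 2%N.
  have := graph_valP G; rewrite /graph_axiom => /forall_inP ax /ax.
  by case/andP => _ /eqP.
have -> : (2 * #|edges G| = \sum_(e in edges G) #|e|)%N.
  by rewrite mulnC -sum_nat_const; apply: eq_bigr => e /axG.
under eq_bigr => e _ do rewrite -sum1_card big_mkcond.
rewrite exchange_big; apply: leq_sum => v _; rewrite -big_mkcondr sum1_card.
apply: leq_trans (leq_imset_card (fun u => [set v; u]) _).
apply: subset_leq_card; apply/subsetP => e; rewrite unfold_in => /andP[eG ve].
have /eqP/cards2P[a [b [_ eE]]] := axG e eG; subst e; apply/imsetP.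
case/set2P: ve => ->; first by exists b; rewrite ?inE.
by exists a; rewrite ?inE 1?setUC.
Qed.

Theorem theorem1p2 :
  exists N : nat, forall n : nat, (N <= n)%N ->
    (max_critical_edges 4 n)%:R < 164 / 1000 * n%:R ^+ 2 :> rat.
Proof.
have [N0 bound] := critical_degree_sum rat; exists N0.+1 => n ltn.
rewrite /max_critical_edges; apply: (big_ind (fun m : nat => m%:R < _)).
- have : 0 < n%:R ^+ 2 :> rat by rewrite exprn_gt0 // ltr0n (leq_trans _ ltn).
  by move: (n%:R ^+ 2) => n2; clear; lra.
- by move=> a b ? ?; rewrite /maxn; case: ifP.
move=> G /andP[/eqP vG crit].
have := bound _ _ (critical_edge_critical vG crit); rewrite card_ord.
move=> /(_ (ltnW ltn)); have := double_card_edges G.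
rewrite -(ler_nat rat) natrM; move: (\sum_v _)%:R (n%:R ^+ 2) => D n2.
by move: (#|edges G|)%:R => e; clear; lra.
Qed.
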